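(* Let $K$ be a field, let $a_1,\ldots,a_n$ be positive integers with $a_1$ the smallest among them, and let $S$ be the numerical semigroup generated by $a_1,\ldots,a_n$. Let $I(S)\subset K[x_1,\ldots,x_n]$ be the kernel of the $K$-algebra homomorphism $K[x_1,\ldots,x_n]\to K[t]$, $x_i\mapsto t^{a_i}$. Let $\mathrm{in}(I(S))$ be its initial ideal with respect to the weighted degree reverse lexicographic order $\prec$ with $x_n,\ldots,x_1$ (with $\deg x_i=a_i$, and $x_1$ the smallest variable). Then: 1. $\mathrm{Ap}(S,a_1)=\{k_2a_2+\cdots+k_na_n \mid (k_2,\ldots,k_n)\in\mathbb N^{n-1},\ x_2^{k_2}\cdots x_n^{k_n}\notin \mathrm{in}(I(S))\}$. In particular, the number of monomials $x_2^{k_2}\cdots x_n^{k_n}$ not in $\mathrm{in}(I(S))$ is $$\mathrm{card}\{x_2^{k_2}\cdots x_n^{k_n}\notin \mathrm{in}(I(S))\}=\frac{a_1}{\gcd(a_1,\ldots,a_n)}.$$ 2. Let $s\in \mathrm{Ap}(S,a_1)$ with $s=k_2a_2+\cdots+k_na_n$, where $(k_2,\ldots,k_n)\in\mathbb N^{n-1}$ and $x_2^{k_2}\cdots x_n^{k_n}\notin \mathrm{in}(I(S))$. If $s=l_2a_2+\cdots+l_na_n$ for some $(l_2,\ldots,l_n)\in\mathbb N^{n-1}$ with $(l_2,\ldots,l_n)\neq(k_2,\ldots,k_n)$, then $x_2^{k_2}\cdots x_n^{k_n}\prec x_2^{l_2}\cdots x_n^{l_n}$.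
   Context: $\mathbb N$ denotes the nonnegative integers, and $S=\{k_1a_1+\cdots+k_na_n\mid k_i\in\mathbb N\}$. The Apéry set of $S$ with respect to $a_1$ is $\mathrm{Ap}(S,a_1)=\{s\in S\mid s-a_1\notin S\}$. The generators $a_i$ are not assumed to be relatively prime. The polynomial ring $K[x_1,\ldots,x_n]$ is graded by $\deg x_i=a_i$. The monomial order $\prec$ is the weighted degree reverse lexicographic order with $x_n\succ\cdots\succ x_1$. Monomials are first compared by weighted degree. If $x^\alpha\ne x^\beta$ have equal weighted degree, then $x^\alpha\succ x^\beta$ if and only if the nonzero entry of $\alpha-\beta$ of smallest index is negative. The initial ideal $\mathrm{in}(I(S))$ is the ideal generated by the leading monomials of all nonzero elements of $I(S)$. *)

(* Defs.v *)
From mathcomp Require Import all_boot all_algebra finmap mpoly.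

Set Implicit Arguments.
Unset Strict Implicit.
Unset Printing Implicit Defensive.

Import GRing.Theory.

Local Open Scope ring_scope.

(* There are n.+1 generators a_1, ..., a_{n+1}; since ordinals start at 0,
   a_1 is [a ord0], x_1 is ['X_ord0], and the remaining generators are
   [a (lift ord0 i)] for i : 'I_n. *)

Section Semigroup.

Variables (n : nat) (a : 'I_n.+1 -> nat).

Definition wdeg (m : 'X_{1..n.+1}) : nat := (\sum_(i < n.+1) m i * a i)%N.

Definition in_semigroup (s : nat) : Prop := exists k : 'X_{1..n.+1}, s = wdeg k.

(* s - a_1 is an integer which may be negative, so that truncated subtraction
   would be wrong here: s - a_1 \in S means that s = t + a_1 with t \in S. *)
Definition in_Apery (s : nat) : Prop :=
  in_semigroup s /\ ~ (exists2 t : nat, in_semigroup t & s = (t + a ord0)%N).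

(* [wdrl_lt m1 m2] is x^m1 \prec x^m2: for equal weighted degrees, the nonzero
   entry of m2 - m1 of smallest index is negative. *)
Definition wdrl_lt (m1 m2 : 'X_{1..n.+1}) : bool :=
  (wdeg m1 < wdeg m2)%N
  || (wdeg m1 == wdeg m2)
     && [exists i : 'I_n.+1,
           (m2 i < m1 i)%N && [forall j : 'I_n.+1, (j < i)%N ==> (m2 j == m1 j)]].

(* The exponents of x_2^{k_2} ... x_{n+1}^{k_{n+1}}. *)
Definition tail_mnm (k : 'X_{1..n}) : 'X_{1..n.+1} :=
  [multinom if unlift ord0 i is Some j then k j else 0%N | i < n.+1].

Definition tail_val (k : 'X_{1..n}) : nat :=
  (\sum_(i < n) k i * a (lift ord0 i))%N.

End Semigroup.

Section InitialIdeal.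

Variables (K : fieldType) (n : nat) (a : 'I_n.+1 -> nat).

Definition semigroup_map (p : {mpoly K[n.+1]}) : {poly K} :=
  mmap (@polyC K) (fun i => 'X^(a i)) p.

Definition in_toric_ideal (p : {mpoly K[n.+1]}) : Prop := semigroup_map p = 0.

Definition is_lead_mnm (p : {mpoly K[n.+1]}) (m : 'X_{1..n.+1}) : Prop :=
  m \in msupp p /\ forall m', m' \in msupp p -> m' != m -> wdrl_lt a m' m.

Definition ideal_generated (R : comNzRingType) (G : R -> Prop) (q : R) : Prop :=
  exists2 s : seq (R * R),
    forall cg, cg \in s -> G cg.2 & q = \sum_(cg <- s) cg.1 * cg.2.

Definition lead_mnms_of_ideal (q : {mpoly K[n.+1]}) : Prop :=
  exists p m,
    [/\ in_toric_ideal p, p != 0, is_lead_mnm p m & q = 'X_[m]].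

Definition in_initial_ideal (q : {mpoly K[n.+1]}) : Prop :=
  ideal_generated lead_mnms_of_ideal q.

Definition standard_tail (k : 'X_{1..n}) : Prop :=
  ~ in_initial_ideal 'X_[tail_mnm k].

End InitialIdeal.

Arguments semigroup_map : clear implicits.
Arguments in_toric_ideal : clear implicits.
Arguments in_initial_ideal : clear implicits.
Arguments standard_tail K {n} a k.

(* Main.v *)
(** A polynomial in I(S) has weighted homogeneous components whose coefficients
    sum to zero, so a leading monomial is never the smallest one of its degree;
    conversely binomials x^m - x^m' with wdeg m = wdeg m' lie in I(S). Hence
    the monomials outside in(I(S)) are exactly the smallest ones of their
    weighted degree. As x_1 is the smallest variable, a monomial divisible by
    x_1 precedes any monomial of the same degree that is not: the minimal
    monomial of degree s is free of x_1 exactly when s is in Ap(S, a_1).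
    Finally Ap(S, a_1) meets every residue class mod a_1 of a multiple of
    gcd(a_1, ..., a_n) exactly once, since by Bezout each such class meets S. *)
Require Import Defs.
From mathcomp Require Import all_boot all_algebra finmap mpoly.
Set Implicit Arguments.
Unset Strict Implicit.
Unset Printing Implicit Defensive.
Import GRing.Theory.

(** * Weighted degrees and monomials free of x_1 *)

Lemma wdegD n (a : 'I_n.+1 -> nat) m1 m2 :
  wdeg a (m1 + m2) = wdeg a m1 + wdeg a m2.
Proof.
by rewrite /wdeg -big_split; apply: eq_bigr => i _ /=; rewrite mnmDE mulnDl.
Qed.

Lemma wdegMn n (a : 'I_n.+1 -> nat) m k : wdeg a (m *+ k) = k * wdeg a m.
Proof.
rewrite /wdeg big_distrr; apply: eq_bigr => i _ /=.
by rewrite mulmnE mulnA; congr (_ * _); rewrite mulnC.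
Qed.

Lemma wdegU n (a : 'I_n.+1 -> nat) i : wdeg a U_(i) = a i.
Proof.
rewrite /wdeg (bigD1 i) //= mnm1E eqxx mul1n big1 ?addn0 // => j ji.
by rewrite mnm1E eq_sym (negPf ji).
Qed.

Lemma mdeg_le_wdeg n (a : 'I_n.+1 -> nat) m :
  (forall i, 0 < a i) -> mdeg m <= wdeg a m.
Proof.
by move=> a_gt0; rewrite mdegE; apply: leq_sum => i _; rewrite leq_pmulr.
Qed.

Lemma tail_mnm0 n (k : 'X_{1..n}) : tail_mnm k ord0 = 0.
Proof. by rewrite mnmE unlift_none. Qed.

Lemma tail_mnm_lift n (k : 'X_{1..n}) i : tail_mnm k (lift ord0 i) = k i.
Proof. by rewrite mnmE liftK. Qed.

Lemma wdeg_tail n (a : 'I_n.+1 -> nat) k : wdeg a (tail_mnm k) = tail_val a k.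
Proof.
rewrite /wdeg big_ord_recl tail_mnm0 add0n.
by apply: eq_bigr => i _; rewrite tail_mnm_lift.
Qed.

Lemma tail_mnm_inj n : injective (@tail_mnm n).
Proof.
move=> k l kl; apply/mnmP => i.
by rewrite -(tail_mnm_lift k) kl tail_mnm_lift.
Qed.

Lemma tail_mnmP n (m : 'X_{1..n.+1}) : m ord0 = 0 -> exists k, m = tail_mnm k.
Proof.
move=> m0; exists [multinom m (lift ord0 i) | i < n].
apply/mnmP => i; case: (unliftP ord0 i) => [j|] ->.
  by rewrite tail_mnm_lift mnmE.
by rewrite tail_mnm0.
Qed.

(** * The order within one weighted degree and its minimal monomials *)

Lemma wdrl_ltP n (a : 'I_n.+1 -> nat) m1 m2 : wdeg a m1 = wdeg a m2 ->
  reflect (exists2 i : 'I_n.+1, m2 i < m1 i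
             & forall j : 'I_n.+1, j < i -> m2 j = m1 j)
          (wdrl_lt a m1 m2).
Proof.
move=> e; rewrite /wdrl_lt e ltnn eqxx /=.
apply: (iffP existsP) => [[i /andP[lt /forallP eq]]|[i lt eq]]; exists i => //.
  by move=> j ji; apply/eqP; move: (eq j); rewrite ji.
by rewrite lt; apply/forallP => j; apply/implyP => /eq ->.
Qed.

Lemma wdrl_ltxx n (a : 'I_n.+1 -> nat) m : wdrl_lt a m m = false.
Proof. by apply/(wdrl_ltP (erefl _)) => -[i]; rewrite ltnn. Qed.

Lemma wdrl_lt_trans n (a : 'I_n.+1 -> nat) m2 m1 m3 :
    wdeg a m1 = wdeg a m2 -> wdeg a m2 = wdeg a m3 ->
  wdrl_lt a m1 m2 -> wdrl_lt a m2 m3 -> wdrl_lt a m1 m3.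
Proof.
move=> e12 e23 /(wdrl_ltP e12)[i lti eqi] /(wdrl_ltP e23)[j ltj eqj].
apply/(wdrl_ltP (etrans e12 e23)).
case: (ltngtP i j) => [ij|ji|/val_inj ij].
- exists i; first by rewrite eqj.
  by move=> k ki; rewrite eqj ?eqi // (ltn_trans ki).
- exists j; first by rewrite -eqi.
  by move=> k kj; rewrite eqj ?eqi // (ltn_trans kj).
- subst j; exists i; first exact: ltn_trans lti.
  by move=> k ki; rewrite eqj ?eqi.
Qed.

Lemma wdrl_lt_total n (a : 'I_n.+1 -> nat) m1 m2 : wdeg a m1 = wdeg a m2 ->
  m1 <> m2 -> wdrl_lt a m1 m2 || wdrl_lt a m2 m1.
Proof.
move=> e ne.
have /existsP[i0 ne0] : [exists i, m1 i != m2 i].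
  apply: contra_notT ne; rewrite negb_exists => /forallP eq.
  by apply/mnmP => i; apply/eqP; move: (eq i); rewrite negbK.
case: (arg_minnP (P := fun i => m1 i != m2 i) (fun i : 'I_n.+1 => i) ne0).
move=> i nei mini.
have eqi (j : 'I_n.+1) : j < i -> m1 j = m2 j.
  by apply: contraTeq => /mini; rewrite -leqNgt.
apply/orP; case: (ltngtP (m1 i) (m2 i)) => [lt|gt|/eqP]; last by rewrite (negPf nei).
  by right; apply/(wdrl_ltP (esym e)); exists i.
by left; apply/(wdrl_ltP e); exists i => // j /eqi.
Qed.

Lemma wdrl_lt_addr n (a : 'I_n.+1 -> nat) c m1 m2 : wdeg a m1 = wdeg a m2 ->
  wdrl_lt a m1 m2 -> wdrl_lt a (m1 + c) (m2 + c).
Proof.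
move=> e /(wdrl_ltP e)[i lt eq].
have e' : wdeg a (m1 + c) = wdeg a (m2 + c) by rewrite !wdegD e.
apply/(wdrl_ltP e'); exists i; first by rewrite !mnmDE ltn_add2r.
by move=> j /eq ej; rewrite !mnmDE ej.
Qed.

(** A field-free substitute for lying outside in(I(S)); the equivalence is
    [monomial_in_initialP]. *)
Definition fiber_min n (a : 'I_n.+1 -> nat) (m : 'X_{1..n.+1}) : Prop :=
  forall m', wdeg a m' = wdeg a m -> ~~ wdrl_lt a m' m.

(** Positive weights bound the total degree by the weighted one, so the monomials of a given
    weighted degree lie in the finite type [B]. *)
Lemma fiber_min_exists n (a : 'I_n.+1 -> nat) m : (forall i, 0 < a i) ->
  exists2 m', wdeg a m' = wdeg a m & fiber_min a m'.
Proof.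
move=> a_gt0; pose B := 'X_{1..n.+1 < (wdeg a m).+1}.
have bnd m' : wdeg a m' = wdeg a m -> exists x : B, m' = x.
  move=> e; have h : mdeg m' < (wdeg a m).+1 by rewrite ltnS -e mdeg_le_wdeg.
  by exists (BMultinom h).
have [x0 e0] := bnd m erefl.
have Px0 : wdeg a x0 == wdeg a m by rewrite -e0.
pose below (x : B) := [set y : B | (wdeg a y == wdeg a m) && wdrl_lt a y x].
(* Minimise the number of predecessors: by transitivity, some [y] below [x] would have strictly
   fewer, since [y] is a predecessor of [x] but not of itself. *)
case: (arg_minnP (P := fun x : B => wdeg a x == wdeg a m)
  (fun x => #|below x|) Px0) => x /eqP ex minx.
exists x => // m' em'; apply/negP => lt.
have [y ey] := bnd m' (etrans em' ex); rewrite {}ey in em' lt.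
have /minx : wdeg a y == wdeg a m by rewrite em' ex.
apply/negP; rewrite -ltnNge; apply/proper_card/properP; split.
  apply/subsetP => z; rewrite !inE => /andP[/eqP ez ltz]; rewrite ez eqxx /=.
  by apply: wdrl_lt_trans ltz lt; rewrite ?ez ?em'.
by exists y; rewrite inE em' ex eqxx /= ?wdrl_ltxx.
Qed.

Lemma fiber_min_uniq n (a : 'I_n.+1 -> nat) m1 m2 :
  fiber_min a m1 -> fiber_min a m2 -> wdeg a m1 = wdeg a m2 -> m1 = m2.
Proof.
move=> min1 min2 e; apply/eqP/negPn/negP => /eqP ne.
by case/orP: (wdrl_lt_total e ne); apply/negP; [apply: min2|apply: min1].
Qed.

(** * The toric ideal and its initial ideal *)

Lemma mmap1_expX (K : fieldType) n (a : 'I_n.+1 -> nat) (m : 'X_{1..n.+1}) :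
  mmap1 (fun i => ('X^(a i) : {poly K})%R) m = ('X^(wdeg a m))%R.
Proof.
rewrite /mmap1 /wdeg -prodrXr.
by apply: eq_bigr => i _; rewrite -exprM mulnC.
Qed.

Lemma coef_semigroup_map (K : fieldType) n (a : 'I_n.+1 -> nat)
    (p : {mpoly K[n.+1]}) d :
  ((semigroup_map K n a p)`_d = \sum_(m <- msupp p | wdeg a m == d) p@_m)%R.
Proof.
rewrite /semigroup_map /mmap coef_sum [RHS]big_mkcond.
apply: eq_bigr => m _ /=.
rewrite mmap1_expX coefCM coefXn eq_sym.
by case: eqP => _; rewrite ?mulr1 ?mulr0.
Qed.

Lemma toric_binomial (K : fieldType) n (a : 'I_n.+1 -> nat) m1 m2 :
  wdeg a m1 = wdeg a m2 -> in_toric_ideal K n a ('X_[m1] - 'X_[m2])%R.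
Proof.
move=> e; rewrite /in_toric_ideal /semigroup_map mmapB !mmapX.
by rewrite !mmap1_expX e subrr.
Qed.

(** Otherwise [m] would be the only monomial of [p] of its weighted degree, and its nonzero
    coefficient would survive in the image of [p] in K[t]. *)
Lemma toric_lead_not_min (K : fieldType) n (a : 'I_n.+1 -> nat)
    (p : {mpoly K[n.+1]}) m :
  in_toric_ideal K n a p -> is_lead_mnm a p m -> ~ fiber_min a m.
Proof.
move=> Ip [mp lead] minm.
have := coef_semigroup_map a p (wdeg a m); rewrite Ip coef0.
rewrite big_mkcond (bigD1_seq m) ?msupp_uniq //= eqxx big_seq_cond big1 ?addr0.
  by move/esym/eqP; rewrite mcoeff_eq0 mp.
move=> m' /andP[m'p ne]; case: eqP => // /minm.
by rewrite (lead _ m'p ne).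
Qed.

(** Multiplying by [c] preserves the order, so non-minimality passes to multiples. *)
Lemma fiber_min_addl n (a : 'I_n.+1 -> nat) c m :
  fiber_min a (m + c) -> fiber_min a m.
Proof.
move=> minm m' e; apply: contra (minm (m' + c)%MM _); last by rewrite !wdegD e.
exact: wdrl_lt_addr.
Qed.

Lemma monomial_in_initialP (K : fieldType) n (a : 'I_n.+1 -> nat)
    (m : 'X_{1..n.+1}) :
  ~ in_initial_ideal K n a 'X_[m]%R <-> fiber_min a m.
Proof.
split=> [notin m' e|minm [s sG eq]].
  apply/negP => lt; apply: notin.
  have ne : m' != m by apply: contraTneq lt => ->; rewrite wdrl_ltxx.
  have cf k : (('X_[m] - 'X_[m'] : {mpoly K[n.+1]})@_k
      = (m == k)%:R - (m' == k)%:R)%R by rewrite mcoeffB !mcoeffX.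
  have cm : (('X_[m] - 'X_[m'] : {mpoly K[n.+1]})@_m = 1)%R.
    by rewrite cf eqxx (negPf ne) subr0.
  (* The binomial x^m - x^m' lies in I(S) and has leading monomial x^m. *)
  exists [:: (1%R, 'X_[m]%R)]; last by rewrite big_seq1 mul1r.
  move=> cg; rewrite inE => /eqP -> /=.
  exists ('X_[m] - 'X_[m'])%R, m; split=> //.
  - exact: toric_binomial.
  - apply/eqP => z; move: cm; rewrite z mcoeff0 => /esym/eqP.
    by rewrite oner_eq0.
  - split; first by rewrite mcoeff_msupp cm oner_eq0.
    move=> k; rewrite mcoeff_msupp cf => + nek.
    rewrite (eq_sym m) (negPf nek) sub0r.
    by case: (m' =P k) => [<-|]; rewrite ?oppr0 ?eqxx.
(* Some summand must contain x^m, so a leading monomial x^m0 divides x^m; then [m0] inherits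
   minimality, which is impossible. *)
have : (('X_[m] : {mpoly K[n.+1]})@_m != 0)%R by rewrite mcoeffX eqxx oner_eq0.
rewrite eq raddf_sum /= big_seq big1 ?eqxx // => -[c g] cg_s /=.
have /= [p [m0 [Ip _ lead ->]]] := sG _ cg_s.
apply/eqP/negPn/negP => nz.
have /msuppM_le : m \in msupp (c * 'X_[m0])%R by rewrite mcoeff_msupp.
case/allpairsP => -[m1 m2] /= [_]; rewrite msuppX inE => /eqP -> em.
by apply: (toric_lead_not_min Ip lead (fiber_min_addl (c := m1) _)); rewrite addmC -em.
Qed.

Lemma standard_tailP (K : fieldType) n (a : 'I_n.+1 -> nat) (k : 'X_{1..n}) :
  standard_tail K a k <-> fiber_min a (tail_mnm k).
Proof. exact: monomial_in_initialP. Qed.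

(** * The Apéry set and residues modulo a_1 *)

Lemma wdrl_lt_tail n (a : 'I_n.+1 -> nat) m (k : 'X_{1..n}) :
  wdeg a m = tail_val a k -> 0 < m ord0 -> wdrl_lt a m (tail_mnm k).
Proof.
rewrite -wdeg_tail => e m0; apply/(wdrl_ltP e).
by exists ord0; rewrite ?tail_mnm0.
Qed.

Lemma mnm_ord0_split n (m : 'X_{1..n.+1}) : 0 < m ord0 ->
  exists m', m = (m' + U_(ord0))%MM.
Proof.
move=> m0; exists (m - U_(ord0))%MM; rewrite submK //.
by apply/mnm_lepP => i; rewrite mnm1E; case: eqP => // <-.
Qed.

Lemma fiber_min_Apery n (a : 'I_n.+1 -> nat) k :
  fiber_min a (tail_mnm k) -> in_Apery a (tail_val a k).
Proof.
move=> mink; split; first by exists (tail_mnm k); rewrite wdeg_tail.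
case=> t [m ->] e.
have em : wdeg a (m + U_(ord0)) = tail_val a k by rewrite wdegD wdegU.
have := mink (m + U_(ord0))%MM; rewrite wdeg_tail => /(_ em)/negP; apply.
by apply: wdrl_lt_tail em _; rewrite mnmDE mnm1E eqxx addn1.
Qed.

Lemma Apery_fiber_min n (a : 'I_n.+1 -> nat) s : (forall i, 0 < a i) ->
  in_Apery a s -> exists2 k, fiber_min a (tail_mnm k) & s = tail_val a k.
Proof.
move=> a_gt0 [[m0 s_m0] notS].
have [m em minm] := fiber_min_exists m0 a_gt0.
have /tail_mnmP[k mk] : m ord0 = 0.
  apply/eqP; rewrite -leqn0 leqNgt; apply/negP => /mnm_ord0_split[m' e].
  apply: notS; exists (wdeg a m'); first by exists m'.
  by rewrite s_m0 -em e wdegD wdegU.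
by exists k; [rewrite -mk|rewrite s_m0 -em mk wdeg_tail].
Qed.

(** If two congruent elements of S differ, the larger is the smaller plus a positive multiple of
    a_1, so subtracting a_1 from it stays in S. *)
Lemma Apery_modn_inj n (a : 'I_n.+1 -> nat) s t :
  in_Apery a s -> in_Apery a t -> s = t %[mod a ord0] -> s = t.
Proof.
have le_of s' t' : in_Apery a s' -> in_Apery a t' ->
    s' = t' %[mod a ord0] -> t' <= s'.
  move=> [[m ->] _] [_ notS] e; rewrite leqNgt; apply/negP => lt; apply: notS.
  have /dvdnP[q eq] : a ord0 %| t' - wdeg a m by rewrite -eqn_mod_dvd ?e // ltnW.
  have t'E : t' = q * a ord0 + wdeg a m by rewrite -eq subnK // ltnW.
  case: q => [|q] in eq t'E; first by rewrite t'E ltnn in lt.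
  exists (wdeg a (U_(ord0) *+ q + m)%MM); first by exists (U_(ord0) *+ q + m)%MM.
  by rewrite wdegD wdegMn wdegU t'E mulSn -addnA addnC.
by move=> As At e; apply/eqP; rewrite eqn_leq !le_of.
Qed.

(** Descent on the weighted degree: pass to the minimal monomial and, while x_1 divides it, cancel
    x_1, which keeps the residue. *)
Lemma fiber_min_residue n (a : 'I_n.+1 -> nat) m : (forall i, 0 < a i) ->
  exists2 k, fiber_min a (tail_mnm k) & tail_val a k = wdeg a m %[mod a ord0].
Proof.
move=> a_gt0; have [d] := ubnP (wdeg a m); elim: d m => // d IH m ltd.
have [m1 em1 min1] := fiber_min_exists m a_gt0.
have [/eqP/tail_mnmP[k mk]|] := boolP (m1 ord0 == 0).
  by exists k; [rewrite -mk|rewrite -em1 mk wdeg_tail].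
rewrite -lt0n => /mnm_ord0_split[m2 m1E].
have e : wdeg a m = wdeg a m2 + a ord0 by rewrite -em1 m1E wdegD wdegU.
have [|k mink ek] := IH m2.
  by apply: leq_trans (ltnSE ltd); rewrite e -addn1 leq_add2l a_gt0.
by exists k; rewrite // ek e modnDr.
Qed.

Lemma gcd_residue n (a : 'I_n.+1 -> nat) : 0 < a ord0 ->
  exists m, wdeg a m = \big[gcdn/0]_(i < n.+1) a i %[mod a ord0].
Proof.
move=> a0; elim/big_ind: _ => [|x y [mx ex] [my ey]|i _].
- exists 0%MM; rewrite /wdeg big1 // => i _; by rewrite mnm0E.
(* The Bezout identity u * x = v * y + gcd requires [x] to be positive. *)
- have [->|x0] := posnP x; first by rewrite gcd0n; exists my.
  case: (egcdnP y x0) => u v e _.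
  (* Exponents cannot be negative, so the coefficient -v is replaced by (a_1 - 1) * v, congruent to
     it modulo a_1. *)
  exists (mx *+ u + my *+ ((a ord0).-1 * v))%MM.
  rewrite wdegD !wdegMn -modnDm -(modnMmr u) ex -(modnMmr _ (wdeg a my)) ey.
  rewrite !modnMmr modnDm e addnC addnA -mulnA -mulSnr prednK //.
  by rewrite mulnC modnMDl.
- by exists U_(i)%MM; rewrite wdegU.
Qed.

Lemma dvdn_gcd_wdeg n (a : 'I_n.+1 -> nat) m :
  \big[gcdn/0]_(i < n.+1) a i %| wdeg a m.
Proof. by apply: dvdn_sum => i _; apply/dvdn_mull/(biggcdn_inf i). Qed.

(** The residues of multiples of d modulo a_1 are i * d for i < [N]; choosing one minimal tail
    monomial [f i] in each class enumerates them all. *)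
Lemma card_fiber_min_tail n (a : 'I_n.+1 -> nat) : (forall i, 0 < a i) ->
  exists2 A : {fset 'X_{1..n.+1}},
    forall m, m \in A <-> exists2 k, fiber_min a (tail_mnm k) & m = tail_mnm k
    & #|` A| = a ord0 %/ \big[gcdn/0]_(i < n.+1) a i.
Proof.
move=> a_gt0; set d := \big[gcdn/0]_(i < n.+1) a i; set N := a ord0 %/ d.
have d_dvd : d %| a ord0 by apply: (biggcdn_inf ord0).
have d_gt0 : 0 < d by apply: dvdn_gt0 d_dvd.
have NdE : N * d = a ord0 by apply: divnK.
have [m0 em0] := gcd_residue (a_gt0 ord0).
have /fin_all_exists[f fP] (i : 'I_N) : exists k,
    fiber_min a (tail_mnm k) /\ tail_val a k = i * d %[mod a ord0].
  have [k mink ek] := fiber_min_residue (m0 *+ i) a_gt0.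
  by exists k; split=> //; rewrite ek wdegMn -modnMmr em0 modnMmr.
(* The numbers i * d are already reduced modulo a_1, so distinct indices give distinct residues. *)
have lt_id (i : 'I_N) : i * d < a ord0 by rewrite -NdE ltn_pmul2r.
have inj : injective (fun i => tail_mnm (f i)).
  move=> i j /tail_mnm_inj fij; apply/val_inj/eqP; rewrite -(eqn_pmul2r d_gt0).
  by rewrite -(modn_small (lt_id i)) -(modn_small (lt_id j)) -(fP i).2 -(fP j).2 fij.
exists [fset tail_mnm (f i) | i in 'I_N]%fset; last first.
  by rewrite card_imfset //= -cardE card_ord.
move=> m; split=> [/imfsetP[i _ ->]|[k mink ->]].
  by exists (f i) => //; have [] := fP i.
pose r := tail_val a k %% a ord0.
have dr : d %| r by rewrite /dvdn modn_dvdm // -wdeg_tail; apply: dvdn_gcd_wdeg.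
have rN : r %/ d < N by rewrite ltn_divLR // NdE ltn_mod.
(* The class of [k] has index r / d. Congruent Apéry elements are equal, and each weighted degree
   has only one minimal monomial, so [k] is the chosen one. *)
apply/imfsetP; exists (Ordinal rN) => //=.
have [minf ef] := fP (Ordinal rN).
apply: (fiber_min_uniq mink minf); rewrite !wdeg_tail.
apply: (Apery_modn_inj (fiber_min_Apery mink) (fiber_min_Apery minf)).
by rewrite ef /= divnK // modn_mod.
Qed.

Theorem corollary3p2 (K : fieldType) (n : nat) (a : 'I_n.+1 -> nat)
    (a_gt0 : forall i, 0 < a i) (a_min : forall i, a ord0 <= a i) :
  [/\ forall s : nat,
        in_Apery a s <->
        exists2 k : 'X_{1..n}, standard_tail K a k & s = tail_val a k,
      exists2 A : {fset 'X_{1..n.+1}},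
        forall m : 'X_{1..n.+1},
          m \in A <->
          exists2 k : 'X_{1..n}, standard_tail K a k & m = tail_mnm k
        & #|` A| = a ord0 %/ \big[gcdn/0]_(i < n.+1) a i
    & forall (s : nat) (k : 'X_{1..n}),
        in_Apery a s -> s = tail_val a k -> standard_tail K a k ->
        forall l : 'X_{1..n},
          s = tail_val a l -> l <> k ->
          wdrl_lt a (tail_mnm k) (tail_mnm l)].
Proof.
have stdP := standard_tailP K a.
split.
- move=> s; split=> [/(Apery_fiber_min a_gt0)[k /stdP std ->]|[k /stdP mink ->]].
    by exists k.
  exact: fiber_min_Apery.
- have [A AP cardA] := card_fiber_min_tail a_gt0.
  by exists A => // m; rewrite AP; split=> -[k /stdP ? ?]; exists k.
- move=> s k _ -> /stdP mink l; rewrite -!wdeg_tail => e lk.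
  have ne : tail_mnm k <> tail_mnm l by move/tail_mnm_inj/esym.
  by case/orP: (wdrl_lt_total e ne) => // /(negP (mink _ (esym e))).
Qed.
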